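(* Let $K\subseteq\mathbb{R}^n$ be a nonempty closed convex cone, $b\in\mathbb{R}^m$, and let $A\in\mathbb{R}^{m\times n}$ have full rank with $m\le n$. Let $T_2$ and $x_0$ be as defined in the context and let $v$ be the infimal displacement vector of $T_2$. Consider the iteration $z^{k+1}=T_2(z^k)$, $k=0,1,\dots$, with any starting point $z^0\in\mathbb{R}^n$. Then $z^k-z^{k+1}\to v$, and (P) is strongly infeasible if and only if $v\ne\mathbf{0}$. In that case the hyperplane $\{x\mid h^Tx=\beta\}$, where $$h=-v\in-(K^*\cap\mathcal{R}(A^T)),\qquad \beta=-(v^Tx_0)/2>0,$$ strictly separates $K$ and $\{x\mid Ax=b\}$; more precisely, for any $y_1\in K$ and $y_2\in\{x\mid Ax=b\}$, $$h^Ty_1<\beta<h^Ty_2.$$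
   Context: A set $K\subseteq\mathbb{R}^n$ is a cone if $K=\lambda K$ for every $\lambda>0$; its dual cone is $K^*=\{u\in\mathbb{R}^n\mid u^Tv\ge0\text{ for all }v\in K\}$. $\|\cdot\|$ is the Euclidean norm and $d(C_1,C_2)=\inf\{\|x-y\|\mid x\in C_1,\ y\in C_2\}$. (P) is the problem: minimize $c^Tx$ subject to $Ax=b$, $x\in K$ (for some $c\in\mathbb{R}^n$). It is strongly infeasible if $d(K,\{x\mid Ax=b\})>0$. For a nonempty closed convex set $C$, $P_C$ is the Euclidean projection onto $C$ and $R_C(x)=2P_C(x)-x$. $\mathcal{N}(A)$ is the null space of $A$ and $\mathcal{R}(A^T)$ is the range of $A^T$. Define $\tilde T(z)=\frac12\left(z+R_{\mathcal{N}(A)}(R_K(z))\right)$, $x_0=A^T(AA^T)^{-1}b$, and $T_2(z)=\tilde T(z)+x_0$. An operator $T:\mathbb{R}^n\to\mathbb{R}^n$ is firmly nonexpansive if $\|T(x)-T(y)\|^2\le\|x-y\|^2-\|(I-T)(x)-(I-T)(y)\|^2$ for all $x,y$; $T_2$ is firmly nonexpansive. For a firmly nonexpansive $T$, the closure $\overline{\mathrm{ran}(I-T)}$ of $\mathrm{ran}(I-T)=\{x-T(x)\mid x\in\mathbb{R}^n\}$ is convex, and the infimal displacement vector of $T$ is $P_{\overline{\mathrm{ran}(I-T)}}(\mathbf{0})$. *)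

(* Defs.v *)
(* R^n is the type of column vectors 'cV[R]_n over an
   arbitrary R : realType. *)
From HB Require Import structures.
From mathcomp Require Import all_boot all_order all_algebra.
From mathcomp Require Import all_classical all_reals all_analysis.

Set Implicit Arguments.
Unset Strict Implicit.
Unset Printing Implicit Defensive.

Import Order.TTheory GRing.Theory Num.Theory.
Import numFieldNormedType.Exports.

Local Open Scope classical_set_scope.
Local Open Scope ring_scope.

Definition dotv (R : realType) (n : nat) (u v : 'cV[R]_n) : R :=
  (u^T *m v) 0 0.

(* The library norm `|x| on 'cV[R]_n is the sup norm, hence this definition;
   both norms induce the library topology, which is the one behind closed,
   closure and --> below. *)
Definition enorm (R : realType) (n : nat) (x : 'cV[R]_n) : R :=
  Num.sqrt (dotv x x).

Definition is_cone (R : realType) (n : nat) (K : set 'cV[R]_n) : Prop :=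
  forall l : R, 0 < l -> K = [set l *: x | x in K].

Definition dual_cone (R : realType) (n : nat) (K : set 'cV[R]_n) :
    set 'cV[R]_n :=
  [set u | forall v, K v -> 0 <= dotv u v].

(* inf is the real-valued infimum: the distance is meaningful for nonempty
   C1 and C2 only (inf set0 = 0). *)
Definition set_dist (R : realType) (n : nat) (C1 C2 : set 'cV[R]_n) : R :=
  inf [set enorm (x - y) | x in C1 & y in C2].

Definition null_space (R : realType) (m n : nat) (A : 'M[R]_(m, n)) :
    set 'cV[R]_n :=
  [set x | A *m x = 0].

Definition col_range (R : realType) (m n : nat) (A : 'M[R]_(m, n)) :
    set 'cV[R]_m :=
  range (fun y : 'cV[R]_n => A *m y).

Definition affine_sols (R : realType) (m n : nat) (A : 'M[R]_(m, n))
    (b : 'cV[R]_m) : set 'cV[R]_n :=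
  [set x | A *m x = b].

(* Strong infeasibility of: minimize c^T x subject to A x = b, x in K.
   It does not involve the objective c. *)
Definition strongly_infeasible (R : realType) (m n : nat) (K : set 'cV[R]_n)
    (A : 'M[R]_(m, n)) (b : 'cV[R]_m) : Prop :=
  0 < set_dist K (affine_sols A b).

(* The Euclidean nearest point of C to x; it exists and is unique when C is
   nonempty, closed and convex (the default value 0 is then irrelevant). *)
Definition proj (R : realType) (n : nat) (C : set 'cV[R]_n) (x : 'cV[R]_n) :
    'cV[R]_n :=
  xget 0 [set p | C p /\ forall q, C q -> enorm (x - p) <= enorm (x - q)].

Definition reflection (R : realType) (n : nat) (C : set 'cV[R]_n)
    (x : 'cV[R]_n) : 'cV[R]_n :=
  2 *: proj C x - x.

Definition Ttilde (R : realType) (m n : nat) (K : set 'cV[R]_n)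
    (A : 'M[R]_(m, n)) (z : 'cV[R]_n) : 'cV[R]_n :=
  2^-1 *: (z + reflection (null_space A) (reflection K z)).

Definition x_0 (R : realType) (m n : nat) (A : 'M[R]_(m, n))
    (b : 'cV[R]_m) : 'cV[R]_n :=
  A^T *m invmx (A *m A^T) *m b.

Definition T2 (R : realType) (m n : nat) (K : set 'cV[R]_n)
    (A : 'M[R]_(m, n)) (b : 'cV[R]_m) (z : 'cV[R]_n) : 'cV[R]_n :=
  Ttilde K A z + x_0 A b.

(* Meaningful for firmly nonexpansive T, for which the closure of
   ran (I - T) is convex. *)
Definition infimal_displacement (R : realType) (n : nat)
    (T : 'cV[R]_n -> 'cV[R]_n) : 'cV[R]_n :=
  proj (closure (range (fun x => x - T x))) 0.

(* Main.v *)
From Pilot Require Import Defs.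
From HB Require Import structures.
From mathcomp Require Import all_boot all_order all_algebra.
From mathcomp Require Import all_classical all_reals all_analysis.
From mathcomp Require Import ring lra.

Set Implicit Arguments.
Unset Strict Implicit.
Unset Printing Implicit Defensive.

Import Order.TTheory GRing.Theory Num.Theory.
Import numFieldNormedType.Exports.
(* [proj] has to denote the Euclidean projection again. *)
Import Pilot.Defs.

Local Open Scope classical_set_scope.
Local Open Scope ring_scope.

(** Let P be the orthogonal projector onto the row space of A, so that 1 - P
    projects onto the null space and y solves A y = b exactly when P y = x_0.
    Write p for the projection of z onto K and q = p - z.  By Moreau's theorem
    p is in K, q is in the dual cone and p is orthogonal to q
    ([moreau]).  Expanding the reflections gives
      z - T2 z = (P p - x_0) - (q - P q)
    ([displacement_T2]): the displacement splits orthogonally into a part in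
    the row space, which measures the gap between p and the affine space, and
    a part in the null space.

    Every P p - x_0 with p in K is itself a displacement, because points of K
    have q = 0; and deleting the null-space part only shortens a displacement.
    So the infimal displacement vector is the shortest vector w of the closure
    of the convex set of gaps P p - x_0, and the norm of w is the distance
    between K and the affine space.  Hence strong infeasibility means w <> 0
    ([gap_strongly_infeasible]).

    The variational inequality for w, with P w = w, reads
      <w, w> <= <w, p> - <w, x_0>   for all p in K
    ([minimal_gap_exists]).  Scaling p in the cone K up and down gives
    <w, p> >= 0 and <w, x_0> <= - <w, w> separately ([linear_lower_bound]).
    As <w, y> = <w, x_0> on the affine space, these two inequalities put K and
    the affine space strictly on either side of the hyperplane at half the
    height.

    The convergence of z_k - z_{k+1} uses only that T2 is firmly nonexpansive
    ([T2_firmly_nonexpansive]) and that <w, w> <= <w, x - T2 x> for all x.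
    A second orbit started at a point of nearly minimal displacement keeps
    its displacements near w, and firm nonexpansiveness makes the squared
    differences between the displacements of two orbits summable
    ([displacement_cvg]). *)

(** * The Euclidean inner product *)

Section InnerProduct.
Context {R : realType} {n : nat}.
Implicit Types (x y z : 'cV[R]_n) (a : R).

Lemma dotvE x y : dotv x y = \sum_i x i 0 * y i 0.
Proof. by rewrite /dotv mxE; apply: eq_bigr => i _; rewrite mxE. Qed.

Lemma dotvC x y : dotv x y = dotv y x.
Proof. by rewrite !dotvE; apply: eq_bigr => i _; rewrite mulrC. Qed.

Lemma dotvDl x y z : dotv (x + y) z = dotv x z + dotv y z.
Proof. by rewrite /dotv linearD /= mulmxDl mxE. Qed.

Lemma dotvZl a x y : dotv (a *: x) y = a * dotv x y.
Proof. by rewrite /dotv linearZ /= -scalemxAl mxE. Qed.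

Lemma dotvNl x y : dotv (- x) y = - dotv x y.
Proof. by rewrite -scaleN1r dotvZl mulN1r. Qed.

Lemma dotvBl x y z : dotv (x - y) z = dotv x z - dotv y z.
Proof. by rewrite dotvDl dotvNl. Qed.

Lemma dotvDr x y z : dotv x (y + z) = dotv x y + dotv x z.
Proof. by rewrite dotvC dotvDl ![dotv _ x]dotvC. Qed.

Lemma dotvZr a x y : dotv x (a *: y) = a * dotv x y.
Proof. by rewrite dotvC dotvZl dotvC. Qed.

Lemma dotvNr x y : dotv x (- y) = - dotv x y.
Proof. by rewrite dotvC dotvNl dotvC. Qed.

Lemma dotvBr x y z : dotv x (y - z) = dotv x y - dotv x z.
Proof. by rewrite dotvDr dotvNr. Qed.

Definition dotv_linear := (dotvBl, dotvBr, dotvDl, dotvDr, dotvNl, dotvNr,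
  dotvZl, dotvZr).

Lemma dotv_sqrB x y : dotv (x - y) (x - y) = dotv x x - 2 * dotv x y + dotv y y.
Proof. by rewrite !dotv_linear [dotv y x]dotvC; ring. Qed.

Lemma dotv_ge0 x : 0 <= dotv x x.
Proof. by rewrite dotvE sumr_ge0 // => i _; rewrite -expr2 sqr_ge0. Qed.

Lemma dotv_sqrB_le x y :
  dotv (x - y) (x - y) <= 2 * dotv x x + 2 * dotv y y.
Proof. by have := dotv_ge0 (x + y); rewrite !dotv_linear; lra. Qed.

Lemma sqr_coord_le_dotv x i : x i 0 ^+ 2 <= dotv x x.
Proof.
rewrite dotvE (bigD1 i) //= -expr2 lerDl sumr_ge0 // => j _.
by rewrite -expr2 sqr_ge0.
Qed.

Lemma dotv_le0 x : dotv x x <= 0 -> x = 0.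
Proof.
move=> x0; apply/colP => i; rewrite mxE; apply/eqP.
by rewrite -sqrf_eq0 eq_le sqr_ge0 (le_trans (sqr_coord_le_dotv x i) x0).
Qed.

Lemma enorm_le x y : (enorm x <= enorm y) = (dotv x x <= dotv y y).
Proof. by rewrite /enorm ler_sqrt ?nnegrE ?dotv_ge0. Qed.

Lemma continuous_dotv (T : topologicalType) (f g : T -> 'cV[R]_n) :
  continuous f -> continuous g -> continuous (fun t => dotv (f t) (g t)).
Proof.
move=> cf cg t; rewrite /continuous_at dotvE.
rewrite (_ : (fun _ => _) = fun t => \sum_i f t i 0 * g t i 0); last first.
  by apply/funext => t'; rewrite dotvE.
apply: (@cvg_big R) => [|i _]; first exact: (@add_continuous R).
apply: cvgM.
  exact: (continuous_comp (cf t) (@coord_continuous _ _ _ i 0 _)).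
exact: (continuous_comp (cg t) (@coord_continuous _ _ _ i 0 _)).
Qed.

Lemma continuous_affine (T : topologicalType) (f : T -> 'cV[R]_n) x a :
  continuous f -> continuous (fun t => x + a *: f t).
Proof.
by move=> cf t; apply: cvgD; [exact: cvg_cst|apply: cvgZr; exact: cf].
Qed.

(** Each coordinate of a vector is bounded by its Euclidean norm, so Euclidean
    convergence implies convergence for the sup norm that defines the topology. *)
Lemma cvg_dotv (T : Type) (F : set_system T) (FF : Filter F) (u : T -> 'cV[R]_n) l :
  (forall e, 0 < e -> \forall t \near F, dotv (u t - l) (u t - l) < e) ->
  u @ F --> l.
Proof.
move=> ul; apply/cvg_ballP => e e0; apply: filterS (ul (e ^+ 2) _).
  move=> t ut; split=> // i j; rewrite (ord1 j) /ball/= distrC.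
  rewrite -(@ltr_pXn2r _ 2) ?nnegrE ?normr_ge0 ?(ltW e0) // real_normK ?num_real //.
  by apply: le_lt_trans ut; have := sqr_coord_le_dotv (u t - l) i; rewrite !mxE.
exact: exprn_gt0.
Qed.

End InnerProduct.

Lemma dotv_mulmxl (R : realType) (m n : nat) (A : 'M[R]_(m, n)) x y :
  dotv (A *m x) y = dotv x (A^T *m y).
Proof. by rewrite /dotv trmx_mul mulmxA. Qed.

(** * Nearest points *)

Lemma closure_sub_closed (T : topologicalType) (S D : set T) :
  S `<=` D -> closed D -> closure S `<=` D.
Proof. by move=> SD /closure_id ->; exact: closureS. Qed.

Lemma closure_image (T U : topologicalType) (f : T -> U) (S : set T)
    (D : set U) :
  continuous f -> (forall s, S s -> D (f s)) ->
  forall s, closure S s -> closure D (f s).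
Proof.
move=> cf SD s; apply: (@closure_sub_closed _ _ (f @^-1` closure D)).
  by move=> t /SD; exact: subset_closure.
by apply: preimage_closed => [t _|]; [exact: cf|exact: closed_closure].
Qed.

Section Nearest.
Context {R : realType} {n : nat}.
Implicit Types (C : set 'cV[R]_n) (x p q : 'cV[R]_n).

Lemma closed_dotv_ge (u : 'cV[R]_n) (a : R) : closed [set x | a <= dotv u x].
Proof.
apply: (@preimage_closed _ _ (dotv u) [set r | a <= r]); last exact: closed_ge.
move=> x _; apply: (@continuous_dotv _ _ _ (fun=> u) id) => t; last exact: cvg_id.
exact: cst_continuous.
Qed.

(** Existence by compactness: only the points of C at most as far from x as a
    given point of C matter, and these form a compact set.
    Transposition brings the problem to row vectors, where closed bounded sets
    are known to be compact. *)
Lemma nearest_exists C x : C !=set0 -> closed C ->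
  exists2 p, C p & forall q, C q -> dotv (x - p) (x - p) <= dotv (x - q) (x - q).
Proof.
move=> [c Cc] Ccl.
have ctr : continuous (fun w : 'rV[R]_n => w^T).
  move=> w S /= /(nbhs_ballP w^T) [e e0 wS]; apply/(nbhs_ballP w).
  exists e => //= t [_ wt]; apply: wS; split=> // i j.
  by rewrite !mxE; exact: wt.
pose f (w : 'rV[R]_n) := dotv (x - w^T) (x - w^T).
have cf : continuous f.
  have cg : continuous (fun w : 'rV[R]_n => x + (-1) *: w^T).
    exact: continuous_affine.
  rewrite (_ : f = fun w => dotv (x + (-1) *: w^T) (x + (-1) *: w^T)).
    exact: continuous_dotv.
  by apply/funext => w; rewrite scaleN1r.
pose B := [set w : 'rV[R]_n | C w^T /\ f w <= f c^T].
have Bcl : closed B.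
  apply: (@closedI _ [set w | C w^T] [set w | f w <= f c^T]).
    by apply: preimage_closed => // w _; exact: ctr.
  by apply: (@preimage_closed _ _ f [set r | r <= f c^T]);
    [move=> w _; exact: cf|exact: closed_le].
have Bbd : bounded_set B.
  exists (`|x^T| + (1 + f c^T)); split; first exact: num_real.
  move=> M ltM w [_ fw]; apply: le_trans (ltW ltM).
  rewrite -[w](subKr x^T) (le_trans (ler_normB _ _)) // lerD2l.
  rewrite [leLHS]/Num.Def.normr /= mx_normrE; apply/bigmax_leP; split=> [|[i j] _ /=].
    by rewrite addr_ge0 ?dotv_ge0.
  have := le_trans (sqr_coord_le_dotv (x - w^T) j) fw.
  rewrite !mxE (ord1 i) => le_f; move: le_f; set r := x j 0 - w 0 j; set y := f c^T.
  by clearbody r y => r2; have [] := ler0P r; nra.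
have B0 : B !=set0 by exists c^T; split; rewrite ?trmxK.
have [w] :=
  EVT_min_rV B0 (bounded_closed_compact Bbd Bcl) (continuous_subspaceT cf).
rewrite inE => -[Cw fw] wmin; exists w^T => // q Cq.
have [fq|fq] := leP (f q^T) (f c^T); last first.
  by apply: le_trans fw (ltW _); rewrite -[q]trmxK.
by have := wmin q^T; rewrite inE /f trmxK; apply; split; rewrite ?trmxK.
Qed.
(** The function t |-> |x - p - t (c - p)|^2 is minimal at t = 0, so its
    derivative there, - 2 <x - p, c - p>, is nonnegative.  Only segments
    from p towards c are used: C will be a closure and c a point of the set
    itself. *)
Lemma nearest_variational C x p c :
  (forall q, C q -> dotv (x - p) (x - p) <= dotv (x - q) (x - q)) ->
  (forall t, 0 < t -> t < 1 -> C (p + t *: (c - p))) ->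
  dotv (x - p) (c - p) <= 0.
Proof.
move=> pmin Cseg; set a := dotv _ _; set s := dotv (c - p) (c - p).
have s0 : 0 <= s by exact: dotv_ge0.
have quad t : 0 < t -> t < 1 -> 2 * a <= t * s.
  move=> t0 t1; have := pmin _ (Cseg t t0 t1).
  rewrite opprD addrA [leRHS]dotv_sqrB dotvZl !dotvZr -/a -/s => le_t.
  by rewrite -(ler_pM2l t0); lra.
rewrite leNgt; apply/negP => a0.
have s1 : 0 < a + s + 1 by lra.
(* This t is below 1 and has t s < 2 a, against [quad]. *)
have := quad (a / (a + s + 1)); rewrite ltr_pdivrMr // divr_gt0 // mul1r.
have -> : a < a + s + 1 by lra.
move=> /(_ isT isT); rewrite mulrAC ler_pdivlMr //; nra.
Qed.

Lemma proj_nearest C x : C !=set0 -> closed C ->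
  C (proj C x) /\
  forall q, C q -> dotv (x - proj C x) (x - proj C x) <= dotv (x - q) (x - q).
Proof.
move=> C0 Ccl; have [p Cp pmin] := nearest_exists x C0 Ccl.
have [|Cpr prmin] := xgetPex 0
  (P := [set p | C p /\ forall q, C q -> enorm (x - p) <= enorm (x - q)]).
  by exists p; split=> // q /pmin; rewrite enorm_le.
by split=> // q /prmin; rewrite enorm_le.
Qed.

(** The variational inequality gives |x - q|^2 >= |x - p|^2 + |q - p|^2 on C, so
    p is the only nearest point.  This identifies the projection on
    the closure of the range of I - T, whose convexity is not at hand. *)
Lemma proj_unique C x p : C p -> (forall q, C q -> dotv (x - p) (q - p) <= 0) ->
  proj C x = p.
Proof.
move=> Cp pvar.
have sqr_dist q : dotv (x - q) (x - q) =
    dotv (x - p) (x - p) - 2 * dotv (x - p) (q - p) + dotv (q - p) (q - p).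
  by rewrite -dotv_sqrB opprB addrA subrK.
have [|Cpr prmin] := xgetPex 0
  (P := [set p | C p /\ forall q, C q -> enorm (x - p) <= enorm (x - q)]).
  exists p; split=> // q /pvar pq; rewrite enorm_le [leRHS]sqr_dist.
  have := dotv_ge0 (q - p); lra.
apply/eqP; rewrite -subr_eq0; apply/eqP/dotv_le0.
have := prmin p Cp; rewrite enorm_le -/(proj C x) sqr_dist.
have := pvar _ Cpr; rewrite -/(proj C x); lra.
Qed.

Lemma proj_id (C : set 'cV[R]_n) x : C x -> proj C x = x.
Proof.
by move=> Cx; apply: proj_unique => // q _; rewrite subrr /dotv trmx0 mul0mx mxE.
Qed.

End Nearest.

(** * Displacements of firmly nonexpansive maps *)

Section Displacement.
Context {R : realType} {n : nat}.
Implicit Types (T : 'cV[R]_n -> 'cV[R]_n) (x y v w : 'cV[R]_n).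

Definition displacement T x := x - T x.

Definition firmly_nonexpansive T := forall x y,
  dotv (T x - T y) (T x - T y) +
    dotv (displacement T x - displacement T y)
         (displacement T x - displacement T y) <= dotv (x - y) (x - y).

(** Firm nonexpansiveness of T is the same as cocoercivity of I - T; this is
    seen by expanding |(x - y) - (D x - D y)|^2, D = I - T. *)
Lemma firmly_nonexpansiveP T :
  (forall x y, dotv (displacement T x - displacement T y)
                    (displacement T x - displacement T y)
               <= dotv (displacement T x - displacement T y) (x - y)) ->
  firmly_nonexpansive T.
Proof.
move=> coco x y; have := coco x y.
have -> : T x - T y = (x - y) - (displacement T x - displacement T y).
  by apply/colP => i; rewrite /displacement !mxE; ring.
rewrite (dotv_sqrB (x - y)).
rewrite [dotv (x - y) (displacement T x - displacement T y)]dotvC; lra.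
Qed.

(** Compare the orbits of x and of T x: T is nonexpansive. *)
Lemma displacement_nonincreasing T x : firmly_nonexpansive T ->
  dotv (displacement T (T x)) (displacement T (T x)) <=
  dotv (displacement T x) (displacement T x).
Proof.
move=> /(_ x (T x)); apply: le_trans.
by rewrite lerDl dotv_ge0.
Qed.

(** The inequality passes from the range to its closure, where it says that w
    satisfies the variational inequality of the projection of 0. *)
Lemma infimal_displacementP T w :
  closure (range (displacement T)) w ->
  (forall x, dotv w w <= dotv w (displacement T x)) ->
  infimal_displacement T = w.
Proof.
move=> ranw wran; apply: proj_unique => // q.
have : closure (range (displacement T)) `<=` [set q | dotv w w <= dotv w q].
  apply: closure_sub_closed; last exact: closed_dotv_ge.
  by move=> _ [x _ <-]; exact: wran.
by move=> /[apply] /=; rewrite sub0r dotvNl dotvBr; lra.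
Qed.

Lemma telescoping_small (a d : nat -> R) :
  (forall k, 0 <= d k) -> (forall k, 0 <= a k) ->
  (forall k, a k + d k.+1 <= d k) ->
  forall e, 0 < e -> \forall k \near \oo, a k < e.
Proof.
move=> d0 a0 ad e e0.
have dcvg : cvgn d.
  apply: nonincreasing_is_cvgn; last by exists 0 => _ [k _ <-].
  by apply/nonincreasing_seqP => k; apply: le_trans (ad k); rewrite lerDr.
have : d k - d k.+1 @[k --> \oo] --> lim (d @ \oo) - lim (d @ \oo).
  by apply: cvgB => //; rewrite (cvg_shiftS d).
rewrite subrr => /cvgr_lt /(_ e e0); apply: filterS => k; apply: le_lt_trans.
by rewrite lerBrDr.
Qed.

(** Let u be an orbit whose first displacement g has |g|^2 < |w|^2 + e / 4.
    All its displacements g_k satisfy this bound too, and together with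
    <w, w> <= <w, g_k> it gives |w - g_k|^2 <= |g_k|^2 - |w|^2 < e / 4.
    The squared differences D k of the displacements of z and u are summable,
    since |z_k - u_k|^2 drops by at least |D k|^2 at every step. *)
Lemma displacement_cvg T w (z : nat -> 'cV[R]_n) :
  firmly_nonexpansive T ->
  closure (range (displacement T)) w ->
  (forall x, dotv w w <= dotv w (displacement T x)) ->
  (forall k, z k.+1 = T (z k)) ->
  z k - z k.+1 @[k --> \oo] --> w.
Proof.
move=> Tfirm ranw wran zS; apply: cvg_dotv => e e0.
have [y yw] : exists y, dotv (displacement T y) (displacement T y) < dotv w w + e / 4.
  have opn : open [set q : 'cV[R]_n | dotv q q < dotv w w + e / 4].
    apply: (@open_comp _ _ (fun q : 'cV[R]_n => dotv q q)
      [set r | r < dotv w w + e / 4]); last exact: open_lt.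
    by move=> q _; apply: (@continuous_dotv _ _ _ id id) => x; exact: cvg_id.
  have [|_ [[y _ <-]]] := ranw _ (open_nbhs_nbhs (conj opn _)).
    by rewrite /= ltrDl divr_gt0.
  by exists y.
pose u k := iter k T y.
have u_le k : dotv (displacement T (u k)) (displacement T (u k)) < dotv w w + e / 4.
  elim: k => // k; apply: le_lt_trans; exact: displacement_nonincreasing.
pose D k := displacement T (z k) - displacement T (u k).
have small : \forall k \near \oo, dotv (D k) (D k) < e / 4.
  apply: (@telescoping_small _ (fun k => dotv (z k - u k) (z k - u k))) => [k|k|k|].
  - exact: dotv_ge0.
  - exact: dotv_ge0.
  - by have := Tfirm (z k) (u k); rewrite addrC zS.
  - by rewrite divr_gt0.
apply: filterS small => k Dk.
have -> : z k - z k.+1 - w = D k - (w - displacement T (u k)).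
  by apply/colP => i; rewrite /D /displacement zS !mxE; ring.
have := u_le k; have := wran (u k).
set g := displacement T (u k) => wg gw.
apply: le_lt_trans (dotv_sqrB_le _ _) _.
rewrite dotv_sqrB; lra.
Qed.

End Displacement.

(** * Closed convex cones *)

Lemma convex_set_segment (R : realType) (n : nat) (C : set 'cV[R]_n) : convex_set C ->
  forall x y t, C x -> C y -> 0 < t -> t < 1 -> C (x + t *: (y - x)).
Proof.
move=> Cconv x y t Cx Cy t0 t1.
have := Cconv y x (Itv01 (ltW t0) (ltW t1)); rewrite !inE => /(_ Cy Cx).
suff -> : x + t *: (y - x) = t *: y + (1 - t) *: x by [].
by apply/colP => i; rewrite !mxE; ring.
Qed.

(** Let t tend to infinity for the first inequality and to 0 for the second. *)
Lemma linear_lower_bound (R : realType) (a s : R) :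
  (forall t, 0 < t -> s <= t * a) -> 0 <= a /\ s <= 0.
Proof.
move=> sa; have a0 : 0 <= a.
  rewrite leNgt; apply/negP => a0.
  have t0 : 0 < (`|s| + 1) / - a.
    by rewrite divr_gt0 ?oppr_gt0 // ltr_wpDl.
  have := sa _ t0; rewrite invrN mulrN mulNr divfK ?lt_eqF //.
  have := ler_norm (- s); rewrite normrN; lra.
split=> //; rewrite leNgt; apply/negP => s0.
have sa1 : s <= a by rewrite -[a]mul1r sa.
have ap : 0 < a by exact: lt_le_trans sa1.
have := sa (s / (2 * a)); rewrite divr_gt0 ?mulr_gt0 // => /(_ isT).
rewrite invfM mulrA divfK ?gt_eqF //; lra.
Qed.

Section Cone.
Context {R : realType} {n : nat} (K : set 'cV[R]_n).
Hypotheses (K_neq0 : K !=set0) (K_closed : closed K).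
Hypotheses (K_convex : convex_set K) (K_cone : is_cone K).

Lemma cone_scale (l : R) x : 0 < l -> K x -> K (l *: x).
Proof. by move=> l0 Kx; rewrite (K_cone l0); exists x. Qed.

(** The variational inequality of the projection p, tested at 2 p and p / 2,
    gives <z - p, p> = 0; tested at c in K it then gives <z - p, c> <= 0. *)
Lemma moreau (z : 'cV[R]_n) :
  [/\ K (proj K z), dual_cone K (proj K z - z) &
      dotv (proj K z - z) (proj K z) = 0].
Proof.
have [Kp pmin] := proj_nearest z K_neq0 K_closed.
have var c : K c -> dotv (z - proj K z) (c - proj K z) <= 0.
  move=> Kc; apply: (@nearest_variational _ _ K) => // t t0 t1.
  exact: convex_set_segment.
have orth : dotv (z - proj K z) (proj K z) = 0.
  have := var _ (cone_scale (ltr0Sn R 1) Kp).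
  have h0 : (0 : R) < 2^-1 by rewrite invr_gt0.
  have := var _ (cone_scale h0 Kp).
  rewrite ![dotv _ (_ - proj K z)]dotvBr !dotvZr; lra.
split=> //; last by rewrite -opprB dotvNl orth oppr0.
move=> c /var; rewrite [dotv _ (c - _)]dotvBr orth -[proj K z - z]opprB dotvNl.
lra.
Qed.

End Cone.

(** * The orthogonal projector onto the row space *)

Section RowProjector.
Context {R : realType} {m n : nat} (A : 'M[R]_(m, n)) (b : 'cV[R]_m).
Hypotheses (hmn : (m <= n)%N) (A_full_rank : \rank A = minn m n).

Definition row_projector : 'M[R]_n := A^T *m invmx (A *m A^T) *m A.
Notation P := row_projector.

(** If v A A^T = 0 then |v A|^2 = 0, and the rows of A are independent. *)
Lemma gram_unit : A *m A^T \in unitmx.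
Proof.
have Afree : row_free A by rewrite /row_free A_full_rank; apply/eqP/minn_idPl.
rewrite -row_free_unit; apply: inj_row_free => v vAA.
have : dotv (v *m A)^T (v *m A)^T <= 0.
  by rewrite /dotv trmxK -mulmxA trmx_mul !mulmxA -[v *m A *m _]mulmxA vAA mul0mx mxE.
move=> /dotv_le0 /(congr1 trmx); rewrite trmxK trmx0 => /eqP.
by rewrite mulmx_free_eq0 // => /eqP.
Qed.

Lemma mulmx_row_projector : A *m P = A.
Proof. by rewrite /P !mulmxA mulmxV ?gram_unit // mul1mx. Qed.

Lemma row_projector_trmx : P^T = P.
Proof. by rewrite /P !trmx_mul trmxK trmx_inv trmx_mul trmxK mulmxA. Qed.

Lemma row_projectorK : P *m P = P.
Proof. by rewrite {1}/P -mulmxA mulmx_row_projector. Qed.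

Lemma dotv_row_projector x y : dotv (P *m x) y = dotv x (P *m y).
Proof. by rewrite dotv_mulmxl row_projector_trmx. Qed.

Lemma x_0_solution : A *m x_0 A b = b.
Proof. by rewrite /x_0 !mulmxA mulmxV ?gram_unit // mul1mx. Qed.

Lemma row_projector_solution y : A *m y = b -> P *m y = x_0 A b.
Proof. by move=> <-; rewrite /x_0 !mulmxA. Qed.

Lemma proj_null_space x : proj (null_space A) x = x - P *m x.
Proof.
apply: proj_unique => [|q Nq].
  by rewrite /null_space /= mulmxBr mulmxA mulmx_row_projector subrr.
have Pq : P *m q = 0 by rewrite /P -mulmxA Nq mulmx0.
rewrite subKr dotv_row_projector !mulmxBr Pq mulmxA row_projectorK subrr subr0.
by rewrite dotvC /dotv trmx0 mul0mx mxE.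
Qed.

(** With p + q = 2 p - z the reflection of z in K, the average of z and the
    reflection of p + q in the null space is p - P (p + q). *)
Lemma displacement_T2 (K : set 'cV[R]_n) z (p := proj K z) (q := p - z) :
  displacement (T2 K A b) z = P *m p - (q - P *m q) - x_0 A b.
Proof.
rewrite /displacement /T2 /Ttilde /reflection proj_null_space -/p.
have -> : 2 *: p - z = p + q by apply/colP => i; rewrite /q !mxE; ring.
rewrite mulmxDr; set Pp := P *m p; set Pq := P *m q.
by apply/colP => i; rewrite /q !mxE; field.
Qed.

End RowProjector.

(** * The minimal displacement of the iteration *)

Section Splitting.
Context {R : realType} {m n : nat} (K : set 'cV[R]_n).
Context (A : 'M[R]_(m, n)) (b : 'cV[R]_m).
Hypotheses (K_neq0 : K !=set0) (K_closed : closed K).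
Hypotheses (K_convex : convex_set K) (K_cone : is_cone K).
Hypotheses (hmn : (m <= n)%N) (A_full_rank : \rank A = minn m n).
Notation P := (row_projector A).
Notation x0 := (x_0 A b).

(** As the two parts of D are orthogonal, <D, dp - dq> differs from |D|^2 by
    - <dp, dq>. *)
Lemma splitting_cocoercive (dp dq : 'cV[R]_n)
    (D := P *m dp - (dq - P *m dq)) :
  dotv dp dq <= 0 -> dotv D D <= dotv D (dp - dq).
Proof.
rewrite /D => dpq.
have Pid u v : dotv (P *m u) (P *m v) = dotv (P *m u) v.
  by rewrite -dotv_row_projector mulmxA row_projectorK.
have Pdqp : dotv (P *m dq) dp = dotv (P *m dp) dq.
  by rewrite dotv_row_projector dotvC.
rewrite !dotv_linear !Pid Pdqp ![dotv dq (P *m _)]dotvC [dotv dq dp]dotvC.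
lra.
Qed.

(** For two Moreau decompositions <p - p', q - q'> = - <p, q'> - <p', q> <= 0,
    as p, p' are in K and q, q' in its dual. *)
Lemma T2_firmly_nonexpansive : firmly_nonexpansive (T2 K A b).
Proof.
apply: firmly_nonexpansiveP => x y; rewrite !displacement_T2 //.
have [Kp Kq pq] := moreau K_neq0 K_closed K_convex K_cone x.
have [Kp' Kq' pq'] := moreau K_neq0 K_closed K_convex K_cone y.
move: (proj K x) (proj K y) Kp Kp' Kq Kq' pq pq' => p p' Kp Kp' Kq Kq' pq pq'.
have [q q_def] : exists q, q = p - x by exists (p - x).
have [q' q'_def] : exists q, q = p' - y by exists (p' - y).
have -> : x - y = (p - p') - (q - q').
  by apply/colP => i; rewrite q_def q'_def !mxE; ring.
rewrite -q_def -q'_def in Kq Kq' pq pq' *.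
have -> : P *m p - (q - P *m q) - x0 - (P *m p' - (q' - P *m q') - x0) =
    P *m (p - p') - ((q - q') - P *m (q - q')).
  rewrite !mulmxBr; move: (P *m p) (P *m p') (P *m q) (P *m q') => *.
  by apply/colP => i; rewrite !mxE; ring.
apply: splitting_cocoercive; have := Kq _ Kp'; have := Kq' _ Kp.
rewrite [dotv (p - p') _]dotvC dotvBl !dotvBr pq pq'; lra.
Qed.

(** The points P (p - y) with p in K and A y = b: the differences of points of K
    and of the affine space, taken modulo the null space of A. *)
Definition row_gap : set 'cV[R]_n := [set P *m p - x0 | p in K].

(** A point z of K is its own projection, so its displacement has no null-space
    part. *)
Lemma row_gap_sub_range : row_gap `<=` range (displacement (T2 K A b)).
Proof.
move=> _ [p Kp <-]; exists p => //.
by rewrite displacement_T2 // proj_id // subrr mulmx0 subrr subr0.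
Qed.

(** Here w is the shortest vector of the closure of the gaps.  It stays in the
    row space, since it is orthogonal to w - P w; the closure inherits segments
    towards points of [row_gap], which yields the variational inequality. *)
Lemma minimal_gap_exists : exists w, [/\ closure row_gap w, P *m w = w &
  forall p, K p -> dotv w w <= dotv w p - dotv w x0].
Proof.
have gap0 : row_gap !=set0 by case: K_neq0 => p Kp; exists (P *m p - x0), p.
have [w gw wmin] : exists2 w, closure row_gap w &
    forall q, closure row_gap q -> dotv (0 - w) (0 - w) <= dotv (0 - q) (0 - q).
  apply: nearest_exists; last exact: closed_closure.
  by case: gap0 => c gc; exists c; exact: subset_closure.
have Px0 : P *m x0 = x0 by apply: row_projector_solution; exact: x_0_solution.
have Pw : P *m w = w.
  pose u := w - P *m w.
  have ugap : row_gap `<=` [set x | 0 <= dotv (- u) x].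
    move=> _ [p Kp <-] /=; rewrite dotvNl /u dotvBl dotv_row_projector //.
    by rewrite mulmxBr Px0 mulmxA row_projectorK // subrr oppr0.
  have := closure_sub_closed ugap (@closed_dotv_ge _ _ _ _) gw.
  rewrite /= => uw.
  apply/eqP; rewrite eq_sym -subr_eq0; apply/eqP/dotv_le0; rewrite -/u.
  rewrite {2}/u dotvBr -(dotv_row_projector A u w) // {2}/u mulmxBr mulmxA.
  rewrite row_projectorK // subrr.
  by move: uw; rewrite dotvNl [dotv 0 w]/dotv trmx0 mul0mx mxE; lra.
exists w; split=> // p Kp.
have gc : closure row_gap (P *m p - x0) by apply: subset_closure; exists p.
have := nearest_variational wmin (c := P *m p - x0).
rewrite sub0r dotvNl dotvBr dotvBr -dotv_row_projector // Pw.
suff seg t : 0 < t -> t < 1 -> closure row_gap (w + t *: (P *m p - x0 - w)).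
  by move=> /(_ seg); lra.
move=> t0 t1; pose f s : 'cV[R]_n := t *: (P *m p - x0) + (1 - t) *: s.
have -> : w + t *: (P *m p - x0 - w) = f w.
  by rewrite /f; set c := _ - x0; apply/colP => i; rewrite !mxE; ring.
apply: (closure_image (f := f)) gw.
  by apply: continuous_affine => s; exact: cvg_id.
move=> _ [p' Kp' <-]; exists (p' + t *: (p - p')); first exact: convex_set_segment.
rewrite mulmxDr -scalemxAr mulmxBr /f; set Pp := P *m p; set Pp' := P *m p'.
by apply/colP => i; rewrite !mxE; ring.
Qed.

(** A vector of the row space does not see the null-space part of a
    displacement. *)
Lemma minimal_gap_displacement w z : P *m w = w ->
  (forall p, K p -> dotv w w <= dotv w p - dotv w x0) ->
  dotv w w <= dotv w (displacement (T2 K A b) z).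
Proof.
move=> Pw wgap; rewrite displacement_T2 //.
have [Kp _ _] := moreau K_neq0 K_closed K_convex K_cone z.
have := wgap _ Kp; move: (proj K z) (proj K z - z) => p q.
rewrite !dotvBr -!(dotv_row_projector A w) // Pw; lra.
Qed.

(** Here <w, w> <= <w, p> - <w, x_0> = <w, p - y>, so w is no longer than
    p - y. *)
Lemma minimal_gap_dist w p y : P *m w = w ->
  (forall p, K p -> dotv w w <= dotv w p - dotv w x0) ->
  K p -> affine_sols A b y -> enorm w <= enorm (p - y).
Proof.
move=> Pw wgap Kp /row_projector_solution Py; rewrite enorm_le.
have := wgap _ Kp; rewrite -Py -dotv_row_projector // Pw -dotvBr.
have := dotv_sqrB w (p - y); have := dotv_ge0 (w - (p - y)); lra.
Qed.

(** The norm of w bounds the distance d of the two sets from below.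
    Conversely every gap P p - x_0 is the difference of p and of the solution
    x_0 + (p - P p), so gaps, and limits of gaps such as w, have norm >= d. *)
Lemma gap_strongly_infeasible w : closure row_gap w -> P *m w = w ->
  (forall p, K p -> dotv w w <= dotv w p - dotv w x0) ->
  strongly_infeasible K A b <-> w != 0.
Proof.
move=> gw Pw wgap; rewrite /strongly_infeasible /set_dist.
set D := [set _ | _ in _ & _ in _]; split.
  move=> D0; apply/eqP => w0.
  have Dlb : has_lbound D by exists 0 => _ [x _ [y _ <-]]; exact: sqrtr_ge0.
  have gapD : row_gap `<=` [set c | inf D ^+ 2 <= dotv c c].
    move=> _ [p Kp <-] /=; rewrite -[leRHS]sqr_sqrtr ?dotv_ge0 //.
    rewrite ler_pXn2r ?nnegrE ?sqrtr_ge0 ?(ltW D0) //.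
    apply: (ge_inf Dlb); exists p => //; exists (x0 + (p - P *m p)).
      rewrite /affine_sols /= mulmxDr x_0_solution // mulmxBr mulmxA.
      by rewrite mulmx_row_projector // subrr addr0.
    by congr enorm; rewrite opprD opprB addrA addrAC subrKC.
  have clD : closed [set c : 'cV[R]_n | inf D ^+ 2 <= dotv c c].
    apply: (@preimage_closed _ _ (fun q : 'cV[R]_n => dotv q q)
      [set r | inf D ^+ 2 <= r]); last exact: closed_ge.
    by move=> q _; apply: (@continuous_dotv _ _ _ id id) => x; exact: cvg_id.
  have := closure_sub_closed gapD clD gw.
  rewrite /= w0 /dotv trmx0 mul0mx mxE leNgt; apply/negP; rewrite negbK.
  exact: exprn_gt0.
move=> w0; have ww : 0 < enorm w.
  rewrite sqrtr_gt0 ltNge; apply/negP => /dotv_le0 /eqP.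
  by rewrite (negbTE w0).
apply: lt_le_trans ww _; apply: lb_le_inf.
  by case: K_neq0 => p Kp; exists (enorm (p - x0)), p => //; exists x0 => //;
    exact: x_0_solution.
by move=> _ [p Kp [y by_ <-]]; exact: minimal_gap_dist.
Qed.

End Splitting.

Theorem theorem7 (R : realType) (m n : nat) (hmn : (m <= n)%N)
    (K : set 'cV[R]_n) (K_neq0 : K !=set0) (K_closed : closed K)
    (K_convex : convex_set K) (K_cone : is_cone K)
    (b : 'cV[R]_m) (A : 'M[R]_(m, n)) (A_full_rank : \rank A = minn m n) :
  let v := infimal_displacement (T2 K A b) in
  let h := - v in
  let beta := - dotv v (x_0 A b) / 2 in
  [/\ forall z : nat -> 'cV[R]_n,
        (forall k, z k.+1 = T2 K A b (z k)) ->
        (z k - z k.+1) @[k --> \oo] --> v,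
      strongly_infeasible K A b <-> v != 0 &
      strongly_infeasible K A b ->
      [/\ [set - w | w in dual_cone K `&` col_range A^T] h,
          0 < beta &
          forall y1 y2 : 'cV[R]_n, K y1 -> affine_sols A b y2 ->
            dotv h y1 < beta /\ beta < dotv h y2]].
Proof.
have [w [gw Pw wgap]] := minimal_gap_exists b K_neq0 K_convex hmn A_full_rank.
have wran : closure (range (displacement (T2 K A b))) w.
  by apply: closureS gw; exact: row_gap_sub_range.
have wdisp z : dotv w w <= dotv w (displacement (T2 K A b) z).
  exact: minimal_gap_displacement.
move=> v h beta; rewrite /beta /h /v (infimal_displacementP wran wdisp).
have Tfirm : firmly_nonexpansive (T2 K A b) by exact: T2_firmly_nonexpansive.
have infeasibleP : strongly_infeasible K A b <-> w != 0.
  exact: gap_strongly_infeasible.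
split=> [z zS|//|/infeasibleP w0]; first exact: displacement_cvg zS.
have cone_bounds y : K y -> 0 <= dotv w y /\ dotv w w + dotv w (x_0 A b) <= 0.
  move=> Ky; apply: linear_lower_bound => t t0.
  by have := wgap _ (cone_scale K_cone t0 Ky); rewrite dotvZr; lra.
have ww : 0 < dotv w w.
  by rewrite ltNge; apply/negP => /dotv_le0 /eqP; rewrite (negbTE w0).
have wx0 : dotv w (x_0 A b) < 0.
  by case: K_neq0 => y /cone_bounds[_]; lra.
split; [|lra|move=> y1 y2 /cone_bounds[wy1 _]].
  exists w => //; split; first by move=> y /cone_bounds[].
  exists (invmx (A *m A^T) *m (A *m w)) => //.
  by rewrite -[RHS]Pw /row_projector !mulmxA.
move=> /row_projector_solution Py2.
rewrite !dotvNl -[in dotv w y2]Pw dotv_row_projector // Py2; lra.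
Qed.
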